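(* Let $\alpha>0$ and $(a,b)\in\mathbb{R}^2$ with $a<b$. If $f\in AC([a,b];\mathbb{R})$, then $\mathcal{D}_b^\alpha f$ exists almost everywhere in $[a,b]$, and can be represented in the form $$\left(\mathcal{D}_b^\alpha f\right)(x)=-f(b)\left[\frac{1}{\alpha}E_1\left(\frac{b-x}{\alpha}\right)\right]+\int_x^b \frac{1}{\alpha}E_1\left(\frac{y-x}{\alpha}\right)\frac{df}{dy}(y)\,dy,\quad \text{for a.e. } x\in[a,b].$$
   Context: $AC([a,b];\mathbb{R})$ is the space of real-valued absolutely continuous functions on $[a,b]$. Let $E_1(x)=\int_x^\infty \frac{e^{-t}}{t}\,dt$ for $x>0$. For $\alpha>0$ and $f\in L^1([a,b];\mathbb{R})$, let $$(J_b^\alpha f)(x)=\frac{1}{\alpha}\int_x^b E_1\left(\frac{t-x}{\alpha}\right)f(t)\,dt\quad\text{for a.e. } x\in[a,b].$$ A function in $L^1([a,b];\mathbb{R})$ has an absolutely continuous representative if it coincides a.e. on $[a,b]$ with a function in $AC([a,b];\mathbb{R})$; it is then identified with that function. If $J_b^\alpha f$ has an absolutely continuous representative, the right-sided fractional derivative of order $\alpha$ of $f$ is $(\mathcal{D}_b^\alpha f)(x)=\frac{d}{dx}(J_b^\alpha f)(x)$ for a.e. $x\in[a,b]$. *)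

(* Defs.v *)
From HB Require Import structures.
From mathcomp Require Import all_boot all_order all_algebra.
From mathcomp Require Import all_classical all_reals all_analysis.
Set Implicit Arguments.
Unset Strict Implicit.
Unset Printing Implicit Defensive.
Import Order.TTheory GRing.Theory Num.Theory.
Import numFieldNormedType.Exports.
Local Open Scope classical_set_scope.
Local Open Scope ring_scope.

(* A function on [a, b] is a total function R -> R whose
   values outside [a, b] play no role. *)

Definition absolutely_continuous_on (R : realType) (a b : R) (f : R -> R) :
    Prop :=
  forall e : R, 0 < e -> exists2 d : R, 0 < d &
    forall (n : nat) (u v : 'I_n -> R),
      (forall i, [/\ a <= u i, u i <= v i & v i <= b]) ->
      trivIset [set: 'I_n] (fun i => `]u i, v i[%classic) ->
      \sum_(i < n) (v i - u i) < d ->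
      \sum_(i < n) `|f (v i) - f (u i)| < e.

Definition is_AC_representative (R : realType) (a b : R) (h g : R -> R) :
    Prop :=
  absolutely_continuous_on a b g /\ ae_eq lebesgue_measure `[a, b]%classic h g.

Definition has_AC_representative (R : realType) (a b : R) (h : R -> R) :
    Prop :=
  exists g : R -> R, is_AC_representative a b h g.

(* The representative is unique on [a, b]; the result is h itself when there
   is none. *)
Definition AC_representative (R : realType) (a b : R) (h : R -> R) : R -> R :=
  xget h [set g | is_AC_representative a b h g].

(* Only meaningful for 0 < x. *)
Definition E1 (R : realType) (x : R) : R :=
  \int[lebesgue_measure]_(t in `[x, +oo[) (expR (- t) / t).

Definition right_fint (R : realType) (alpha b : R) (f : R -> R) (x : R) : R :=
  alpha^-1 * \int[lebesgue_measure]_(t in `[x, b])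
    (E1 ((t - x) / alpha) * f t).

(* Only meaningful if right_fint alpha b f has an absolutely continuous
   representative on [a, b], and at the points where that representative is
   differentiable. *)
Definition right_fderiv (R : realType) (alpha a b : R) (f : R -> R) : R -> R :=
  (AC_representative a b (right_fint alpha b f))^`()%classic.

Definition right_fderiv_exists_ae (R : realType) (alpha a b : R)
    (f : R -> R) : Prop :=
  has_AC_representative a b (right_fint alpha b f) /\
  {ae lebesgue_measure, forall x : R, x \in `[a, b] ->
     derivable (AC_representative a b (right_fint alpha b f)) x 1}.

(* Main.v *)
Require Import Defs.
From HB Require Import structures.
From mathcomp Require Import all_boot all_order all_algebra.
From mathcomp Require Import all_classical all_reals all_analysis.
From mathcomp Require Import measurable_realfun lra.
Import Order.TTheory GRing.Theory Num.Theory.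
Import numFieldNormedType.Exports.
Set Implicit Arguments.
Unset Strict Implicit.
Unset Printing Implicit Defensive.
Local Open Scope classical_set_scope.
Local Open Scope ring_scope.

(* An absolutely continuous f has the form f x = f b - int_x^b h with h
   integrable: writing f as a difference of nondecreasing absolutely continuous
   functions, each of their Stieltjes measures is dominated by Lebesgue measure,
   and h is a difference of Radon-Nikodym densities; Lebesgue differentiation
   gives f' = h a.e. With K s = E_1(s / alpha) / alpha on s >= 0 and K = 0
   elsewhere, K is integrable on the line. Fubini's theorem and the
   substitution t |-> x + y - t turn
     J f x = int_x^b K (t - x) (f b - int_t^oo h) dt
   into int_x^oo G with G s = f b * K (b - s) - int K (y - s) h y dy integrable,
   so that J f is absolutely continuous with derivative - G a.e. *)

(** * Absolute continuity and total variation *)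

Definition nonoverlapping (R : realType) (p q : R * R) : bool :=
  (p.2 <= q.1) || (q.2 <= p.1).

Definition nonoverlapping_family (R : realType) (a b : R) (s : seq (R * R)) :=
  all (fun p => [&& a <= p.1, p.1 <= p.2 & p.2 <= b]) s &&
  pairwise (@nonoverlapping R) s.

Definition total_length (R : realType) (s : seq (R * R)) : R :=
  \sum_(p <- s) (p.2 - p.1).

(** Lists of pairs replace families indexed by ['I_n], so that intervals can be subdivided and lists
    concatenated by induction. *)
Definition abs_cont (R : realType) (a b : R) (f : R -> R) : Prop :=
  forall e : R, 0 < e -> exists2 d : R, 0 < d &
    forall s, nonoverlapping_family a b s -> total_length s < d ->
    \sum_(p <- s) `|f p.2 - f p.1| < e.

Section abs_cont.
Variable R : realType.
Implicit Types (a b x u v e d : R) (f g : R -> R) (s t : seq (R * R)) (l : seq R).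
Local Notation sep := (@nonoverlapping R).
Local Notation fam := (@nonoverlapping_family R).
Local Notation len := (@total_length R).

Lemma nonoverlapping_sym : symmetric sep.
Proof. by move=> p q; rewrite /nonoverlapping orbC. Qed.

Lemma absolutely_continuous_on_abs_cont a b f :
  absolutely_continuous_on a b f -> abs_cont a b f.
Proof.
move=> acf e e0; have [d d0 H] := acf e e0; exists d => // s /andP[/allP sab sp].
rewrite /total_length (big_nth (0, 0)) big_mkord => sd.
rewrite (big_nth (0, 0)) big_mkord.
apply: (H _ (fun i => (nth (0, 0) s i).1) (fun i => (nth (0, 0) s i).2)) => //.
  by move=> i; apply/and3P; apply: sab; exact: mem_nth.
apply/trivIsetP => i j _ _; wlog ij : i j / (i < j)%N => [wl ij|_].
  have := ij; rewrite neq_ltn => /orP[|] lij; first exact: wl.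
  by rewrite setIC; apply: wl => //; rewrite eq_sym.
have /(pairwiseP (0, 0)) := sp => /(_ i j).
rewrite !inE => /(_ (ltn_ord i) (ltn_ord j) ij).
rewrite -subset0 => h x /= []; rewrite !in_itv/= => /andP[x1 x2] /andP[x3 x4].
by move: h => /orP[] h; lra.
Qed.

Lemma abs_contD a b f g :
  abs_cont a b f -> abs_cont a b g -> abs_cont a b (f \+ g).
Proof.
move=> acf acg e e0; have e20 : 0 < e / 2 by rewrite divr_gt0.
have [d1 d10 H1] := acf _ e20; have [d2 d20 H2] := acg _ e20.
exists (Num.min d1 d2) => [|s sf]; first by rewrite lt_min d10.
rewrite lt_min => /andP[sd1 sd2]; rewrite [e]splitr.
apply: le_lt_trans (ltrD (H1 s sf sd1) (H2 s sf sd2)).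
rewrite -big_split/=; apply: ler_sum => p _.
by rewrite opprD addrACA ler_normD.
Qed.

(** [zip] stops at the shorter list: these are the cells of the partition with left end [x], a point
    that [itv_partition] leaves out of its list. *)
Definition consecutive x l := zip (x :: l) l.

Lemma consecutive_cons x y l : consecutive x (y :: l) = (x, y) :: consecutive y l.
Proof. by []. Qed.

Lemma all_consecutive x l : path <%R x l ->
  all (fun p => [&& x <= p.1, p.1 <= p.2 & p.2 <= last x l]) (consecutive x l).
Proof.
elim: l x => // y l ih x /= /andP[xy yl]; rewrite lexx (ltW xy)/=.
have ylast : y <= last y l by apply: (@itv_partition_le _ _ _ _ l); split.
rewrite ylast/=; apply: sub_all (ih _ yl) => p /and3P[yp -> ->].
by rewrite (le_trans (ltW xy)).
Qed.

Lemma pairwise_consecutive x l : path <%R x l -> pairwise sep (consecutive x l).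
Proof.
elim: l x => // y l ih x /= /andP[xy yl]; rewrite ih// andbT.
apply: sub_all (all_consecutive yl) => p /and3P[yp _ _].
by rewrite /nonoverlapping/= yp.
Qed.

Lemma total_length_consecutive x l : len (consecutive x l) = last x l - x.
Proof.
rewrite /total_length.
elim: l x => [x|y l ih x]; first by rewrite big_nil subrr.
by rewrite consecutive_cons big_cons ih/=; lra.
Qed.

Lemma variation_consecutive a b f l : itv_partition a b l ->
  variation a b f l = \sum_(p <- consecutive a l) `|f p.2 - f p.1|.
Proof.
elim: l a => [a|y l ih a abl]; first by rewrite /variation /= !big_nil.
rewrite consecutive_cons big_cons -ih; last exact: itv_partition_cons abl.
by rewrite /variation /= big_nat_recl.
Qed.

Lemma nonoverlapping_sub x y p q : nonoverlapping (x, y) q ->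
  x <= p.1 -> p.2 <= y -> nonoverlapping p q.
Proof.
move=> /orP[]/= h xp py; rewrite /nonoverlapping; first by rewrite (le_trans py).
by rewrite (le_trans h) ?orbT.
Qed.

(* Supremum over the partitions of the intervals of t, one interval at a time. *)
Lemma sum_total_variation_le a b f e d :
  (forall s, fam a b s -> len s < d -> \sum_(p <- s) `|f p.2 - f p.1| <= e) ->
  forall t s, fam a b (s ++ t) -> len (s ++ t) < d ->
  ((\sum_(p <- s) `|f p.2 - f p.1|)%:E +
   \sum_(p <- t) total_variation p.1 p.2 f <= e%:E)%E.
Proof.
move=> H; elim=> [s|[x y] t ih s].
  by rewrite cats0 big_nil adde0 lee_fin => *; exact: H.
move=> fst lst; rewrite big_cons/=.
have /andP[/allP/(_ (x, y))] := fst.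
rewrite mem_cat inE eqxx orbT => /(_ erefl) /and3P[/= ax xy yb] _.
have tv0 : (0 <= \sum_(p <- t) total_variation p.1 p.2 f)%E.
  rewrite big_seq; apply: sume_ge0 => p pt; apply: total_variation_ge0.
  have /andP[/allP/(_ p)] := fst; rewrite mem_cat inE pt !orbT.
  by move=> /(_ erefl) /and3P[].
(* Cut [[x, y]] along [l] and move its cells into [s]; the total length is unchanged and the
   induction hypothesis applies. *)
have main l : itv_partition x y l -> ((\sum_(p <- s) `|f p.2 - f p.1| +
    variation x y f l)%:E + \sum_(p <- t) total_variation p.1 p.2 f <= e%:E)%E.
  move=> xyl; have [xl /eqP ly] := xyl.
  rewrite (variation_consecutive _ xyl) -big_cat/=; apply: ih.
    move: fst; rewrite /nonoverlapping_family !all_cat !pairwise_cat/=.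
    have := all_consecutive xl; rewrite ly => al.
    have inC p : p \in consecutive x l -> [&& x <= p.1, p.1 <= p.2 & p.2 <= y].
      exact: (allP al).
    rewrite allrel_consr !allrel_catl (pairwise_consecutive xl).
    move=> /andP[/and3P[-> _ ->]].
    move=> /and4P[/andP[sxy ->] -> xyt ->]; rewrite !andbT/=.
    apply/and3P; split.
    - by apply: sub_all al => p /and3P[xp -> py]; rewrite (le_trans ax)//= (le_trans py).
    - apply/allrelP => p q pC qt; have /and3P[? ? ?] := inC _ pC.
      by rewrite (@nonoverlapping_sub x y)//; exact: (allP xyt _ qt).
    - apply/allrelP => p q ps qC; have /and3P[? ? ?] := inC _ qC.
      rewrite nonoverlapping_sym (@nonoverlapping_sub x y)// nonoverlapping_sym.
      exact: (allP sxy _ ps).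
  move: lst; rewrite -catA /total_length !big_cat/= big_cons.
  have := total_length_consecutive x l; rewrite /total_length ly => ->.
  by rewrite addrA.
(* A single partition of [[x, y]] shows that the sum over [t] is at most [e], hence finite, so it
   can be moved to the right before the supremum is taken. *)
have [l0 xyl0] : exists l, itv_partition x y l.
  have [->|xNy] := eqVneq x y; first by exists [::].
  by exists [:: y]; apply: itv_partition1; rewrite lt_neqAle xNy.
have S0 : 0 <= \sum_(p <- s) `|f p.2 - f p.1| by exact: sumr_ge0.
have tvfin : (\sum_(p <- t) total_variation p.1 p.2 f)%E \is a fin_num.
  rewrite ge0_fin_numE//; apply: le_lt_trans (ltry e).
  by apply: le_trans (main _ xyl0); rewrite leeDr// lee_fin addr_ge0// variation_ge0.
rewrite addeA -leeBrDr// -leeBrDl//; apply: ge_ereal_sup => _ [_ [l xyl <-] <-].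
by rewrite leeBrDl// leeBrDr// -EFinD; exact: main.
Qed.

Lemma abs_cont_sum_total_variation a b f e : abs_cont a b f -> 0 < e ->
  exists2 d, 0 < d & forall s, fam a b s -> len s < d ->
    (\sum_(p <- s) total_variation p.1 p.2 f <= e%:E)%E.
Proof.
move=> acf e0; have [d d0 H] := acf e e0; exists d => // s sf sd.
have := @sum_total_variation_le a b f e d _ s [::] sf sd.
by rewrite big_nil add0e; apply => {sf sd}s sf sd; exact/ltW/H.
Qed.

(** The variation is at most 1 over any subinterval shorter than [d]; an induction peels off pieces
    of length [d / 2] from the right end of [[u, v]]. *)
Lemma abs_cont_total_variation_fin a b f u v : abs_cont a b f ->
  a <= u -> u <= v -> v <= b -> total_variation u v f \is a fin_num.
Proof.
move=> acf au + vb.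
have [d d0 H] := abs_cont_sum_total_variation acf ltr01.
have short x y : a <= x -> x <= y -> y <= b -> y - x < d ->
    total_variation x y f \is a fin_num.
  move=> ax xy yb xyd; rewrite ge0_fin_numE ?total_variation_ge0//.
  have := H [:: (x, y)]; rewrite /nonoverlapping_family/= ax xy yb.
  rewrite /total_length !big_seq1/= => /(_ erefl xyd) h.
  exact: le_lt_trans h (ltry _).
have [n] : exists n : nat, v - u < n.+1%:R * (d / 2).
  exists (Num.truncn ((v - u) / (d / 2))); rewrite -ltr_pdivrMr ?divr_gt0//.
  exact: truncnS_gt.
elim: n v vb => [|n ih] v vb vun uv.
  by apply: short => //; lra.
have [uvd|uvd] := leP u (v - d / 2); last by apply: short => //; lra.
rewrite (@total_variationD _ u v (v - d / 2))//; last lra.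
by rewrite fin_numD ih ?short//; try lra; move: vun; rewrite -natr1; lra.
Qed.

Definition variation_function a f x : R := fine (total_variation a x f).

Lemma variation_functionB a b f u v : abs_cont a b f ->
  a <= u -> u <= v -> v <= b ->
  variation_function a f v - variation_function a f u =
  fine (total_variation u v f).
Proof.
move=> acf au uv vb; have av := le_trans au uv.
have fu := abs_cont_total_variation_fin acf (lexx a) au (le_trans uv vb).
have fv := abs_cont_total_variation_fin acf au uv vb.
rewrite /variation_function (total_variationD f au uv) fineD//.
by rewrite addrAC subrr add0r.
Qed.

(** Makes both the variation function and its sum with [f] nondecreasing, and [f] is the difference
    of the two. *)
Lemma le_norm_variation_functionB a b f u v : abs_cont a b f ->
  a <= u -> u <= v -> v <= b ->
  `|f v - f u| <= variation_function a f v - variation_function a f u.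
Proof.
move=> acf au uv vb; rewrite (variation_functionB acf)// -lee_fin fineK.
  exact: total_variation_ge.
exact: abs_cont_total_variation_fin acf _ _ _.
Qed.

Lemma abs_cont_variation_function a b f : abs_cont a b f ->
  abs_cont a b (variation_function a f).
Proof.
(* Only [<=] survives the supremum, so the strict bound by [e] is obtained from [e / 2]. *)
move=> acf e e0; have e20 : 0 < e / 2 by rewrite divr_gt0.
have [d d0 H] := abs_cont_sum_total_variation acf e20.
exists d => // s sf sd; apply: (@le_lt_trans _ _ (e / 2)); last lra.
have := H s sf sd; rewrite -lee_fin; apply: le_trans.
have /andP[/allP sab _] := sf.
rewrite -sumEFin big_seq [leRHS]big_seq; apply: lee_sum => p /sab /and3P[ap pp pb].
rewrite (variation_functionB acf)// ger0_norm.
  by rewrite fineK// (abs_cont_total_variation_fin acf).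
exact/fine_ge0/total_variation_ge0.
Qed.

End abs_cont.

(** * Stieltjes measures and Radon-Nikodym densities *)

Section stieltjes.
Variable R : realType.
Implicit Types (a b x u v e d : R) (f g F : R -> R).
Local Notation mu := (@lebesgue_measure R).

(** Projection onto [[a, b]]. Composing with it extends a function on [[a, b]] to the line by its
    end values, so that it can define a Stieltjes measure. *)
Definition clamp a b x : R := Num.max a (Num.min x b).

Lemma clamp_itv a b x : a <= b -> a <= clamp a b x <= b.
Proof. by move=> ab; rewrite /clamp le_max lexx/= ge_max ab ge_min lexx orbT. Qed.

Lemma clamp_id a b x : a <= x -> x <= b -> clamp a b x = x.
Proof. by move=> ax xb; rewrite /clamp min_l// max_r. Qed.

Lemma le_clamp a b x y : x <= y -> clamp a b x <= clamp a b y.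
Proof.
move=> xy; rewrite /clamp ge_max !le_max lexx/=.
by apply/orP; right; rewrite le_min !ge_min xy lexx orbT.
Qed.

Lemma clampB_le a b x y : a <= b -> x <= y -> clamp a b y - clamp a b x <= y - x.
Proof.
move=> ab xy; rewrite /clamp !maxEle !minEle; do 4?case: ifPn; lra.
Qed.

Lemma lebesgue_stieltjes_measure_oc (f : cumulative R R) u v : u <= v ->
  lebesgue_stieltjes_measure f `]u, v]%classic = (f v - f u)%:E.
Proof.
move=> uv; rewrite /lebesgue_stieltjes_measure /measure_extension/=.
rewrite measurable_mu_extE/=; last exact: is_ocitv.
by rewrite wlength_itv_bnd.
Qed.

(** [clamp] does not increase distances, so one interval shorter than [d] suffices. *)
Lemma abs_cont_clamp_right_continuous a b F : a <= b -> abs_cont a b F ->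
  right_continuous (F \o clamp a b).
Proof.
move=> ab acF x; apply/cvgrPdist_lt => e e0; have [d d0 H] := acF e e0.
near=> y; have xy : x <= y by near: y; exact: nbhs_right_ge.
have yd : y - x < d.
  by rewrite ltrBlDl; near: y; apply: nbhs_right_lt; rewrite ltrDl.
have /andP[ax xb] := clamp_itv x ab; have /andP[ay yb] := clamp_itv y ab.
have := H [:: (clamp a b x, clamp a b y)].
rewrite /nonoverlapping_family /total_length/= ax yb le_clamp// !big_seq1/=.
rewrite distrC; apply=> //; apply: le_lt_trans yd; exact: clampB_le.
Unshelve. all: by end_near. Qed.

(** Absolute continuity speaks of finite families of intervals; this extracts such a family, with
    chosen endpoints, from a set of the ring generated by half-open intervals. *)
Lemma setring_ocitv (B : set R) :
  measurable (B : set (SetRing.type (ocitv_type R))) ->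
  exists (S : seq (set R)) (p : set R -> R * R),
    [/\ uniq S, {in S &, forall X Y, X != Y -> X `&` Y = set0},
        {in S, forall X, (p X).1 < (p X).2 /\ X = `](p X).1, (p X).2]%classic} &
        B = \big[setU/set0]_(X <- S) X].
Proof.
move=> /SetRing.ring_finite_set[D [/finite_seqP[S0 DS0] D0 Dtriv Dm BD]].
(* Repetitions are removed so that a sum over the list counts each interval once. *)
pose S := undup S0; have DS : D = [set` S].
  by rewrite DS0; apply/seteqP; split=> X /=; rewrite mem_undup.
have /choice[p pP] : forall X : set R, exists q : R * R,
    X \in S -> q.1 < q.2 /\ X = `]q.1, q.2]%classic.
  move=> X; have [XS|_] := boolP (X \in S); last by exists (0, 0).
  have DX : D X by rewrite DS.
  have [q _ Xq] : ocitv X by apply: Dm; rewrite inE.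
  exists q => _; split => //; rewrite ltNge; apply/negP => q21.
  have := D0 _ DX; rewrite -Xq => -[z]/=; rewrite in_itv/= => /andP[qz zq].
  by have := lt_le_trans qz (le_trans zq q21); rewrite ltxx.
exists S, p; split.
- exact: undup_uniq.
- move=> X Y XS YS /eqP XY; apply/eqP/negP => /negP/set0P XY0; apply: XY.
  by apply: Dtriv => //; rewrite DS.
- by move=> X; exact: pP.
- by rewrite BD DS bigcup_seq.
Qed.

Lemma measure_seq_disjoint (disp : measure_display) (T : measurableType disp)
    (m : {measure set T -> \bar R}) (S : seq (set T)) : uniq S ->
  {in S &, forall X Y, X != Y -> X `&` Y = set0} ->
  {in S, forall X, measurable X} ->
  m (\big[setU/set0]_(X <- S) X) = (\sum_(X <- S) m X)%E.
Proof.
elim: S => [|X S ih]; first by rewrite !big_nil measure0.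
move=> /= /andP[XS uS] dS mS; rewrite !big_cons measureU.
- congr (_ + _)%E; apply: ih => // [Y Z YS ZS|Y YS].
    by apply: dS; rewrite inE ?YS ?ZS orbT.
  by apply: mS; rewrite inE YS orbT.
- by apply: mS; rewrite mem_head.
- rewrite big_seq; apply: bigsetU_measurable => Y YS.
  by apply: mS; rewrite inE YS orbT.
- rewrite big_distrr/= big_seq big1// => Y YS; apply: dS.
  + by rewrite mem_head.
  + by rewrite inE YS orbT.
  + by apply: contraNneq XS => ->.
Qed.

Section nondecreasing.
Variables (a b : R) (F : R -> R).
Hypotheses (ab : a <= b) (acF : abs_cont a b F).
Hypothesis ndF : {in `[a, b] &, {homo F : x y / x <= y}}.

Let G : R -> R := F \o clamp a b.

Let ndG : nondecreasing G.
Proof.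
by move=> x y xy; apply: ndF; rewrite ?in_itv/= ?clamp_itv ?le_clamp.
Qed.

HB.instance Definition _ :=
  isCumulative.Build R _ R G ndG (abs_cont_clamp_right_continuous ab acF).

Local Notation nu := (lebesgue_stieltjes_measure G).

(** On a finite disjoint union of half-open intervals, [mu] is the total length and [nu] the sum of
    the increments of [G], so this is the absolute continuity of [F] after clamping. *)
Let stieltjes_ring_le e : 0 < e -> exists2 d, 0 < d & forall B : set R,
  measurable (B : set (SetRing.type (ocitv_type R))) ->
  (mu B < d%:E)%E -> (nu B <= e%:E)%E.
Proof.
move=> e0; have [d d0 H] := acF e0; exists d => // B.
move=> /setring_ocitv[S [p [uS dS pS ->]]].
have mS : {in S, forall X : set R, measurable X}.
  by move=> X /pS[_ ->]; exact: measurable_itv.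
have muS : (\sum_(X <- S) mu X = \sum_(X <- S) ((p X).2 - (p X).1)%:E)%E.
  rewrite big_seq [RHS]big_seq; apply: eq_bigr => X XS; have [p12 Xp] := pS X XS.
  by rewrite {1}Xp lebesgue_measure_itv/= lte_fin p12 EFinB.
have nuS : (\sum_(X <- S) nu X = \sum_(X <- S) (G (p X).2 - G (p X).1)%:E)%E.
  rewrite big_seq [RHS]big_seq; apply: eq_bigr => X XS; have [p12 Xp] := pS X XS.
  by rewrite {1}Xp lebesgue_stieltjes_measure_oc ?ltW.
rewrite !measure_seq_disjoint// muS nuS !sumEFin lte_fin lee_fin => Sd.
have /andP[? ?] := clamp_itv a ab.
have := H [seq (clamp a b (p X).1, clamp a b (p X).2) | X <- S].
rewrite /nonoverlapping_family /total_length !big_map/= => /(_ _ _)/ltW h.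
apply: le_trans (h _ _).
- by apply: ler_sum => X _; rewrite ler_norm.
- apply/andP; split.
    apply/allP => _ /mapP[X /pS[/ltW pX _] ->]/=.
    have /andP[-> _] := clamp_itv (p X).1 ab.
    by have /andP[_ ->] := clamp_itv (p X).2 ab; rewrite le_clamp.
  move: uS; rewrite uniq_pairwise pairwise_map.
  apply: (@sub_in_pairwise _ (mem S)); last exact/allP.
  move=> X Y XS YS /= /(dS X Y XS YS) XY0.
  have [pX XE] := pS X XS; have [pY YE] := pS Y YS.
  rewrite {1}XE {1}YE in XY0.
  rewrite /nonoverlapping/=.
  have [XY|YX] := leP (p X).2 (p Y).1; first by rewrite (le_clamp a b XY).
  have [YX'|XY'] := leP (p Y).2 (p X).1; first by rewrite (le_clamp a b YX') orbT.
  (* The smaller of the two right ends would lie in both intervals. *)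
  exfalso; have : set0 (Num.min (p X).2 (p Y).2); last by [].
  rewrite -XY0; split; rewrite /= in_itv/= ?ge_min ?lexx ?orbT ?andbT.
    by rewrite lt_min pX XY'.
  by rewrite lt_min pY YX.
- apply: le_lt_trans Sd; rewrite big_seq [leRHS]big_seq; apply: ler_sum => X XS.
  by apply: clampB_le => //; apply/ltW; have [] := pS X XS.
Qed.

(** A null set has countable covers by half-open intervals of total length below any [d]. Finite
    unions of the cover lie in the ring, where [stieltjes_ring_le] bounds [nu], and continuity from
    below carries the bound to the whole cover. *)
Lemma stieltjes_dominated : nu `<< mu.
Proof.
apply/null_content_dominatesP => A mA muA0.
apply/eqP; rewrite eq_le measure_ge0 andbT; apply/lee_addgt0Pr => e e0.
rewrite add0e; have [d d0 H] := stieltjes_ring_le e0.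
have /ereal_inf_lt[_ [B [mB AB] <-] Bd] : (mu A < d%:E)%E by rewrite muA0 lte_fin.
have mB' k : measurable (B k : set R) by apply: sub_sigma_algebra; exact: mB.
pose U n : set R := \big[setU/set0]_(k < n.+1) B k.
have UE : \bigcup_n U n = \bigcup_n B n :> set R.
  exact: (@bigcup_bigsetU_bigcup R (fun k => B k : set R)).
have mU n : measurable (U n) by exact: bigsetU_measurable.
apply: (@le_trans _ _ (nu (\bigcup_n U n))).
  have mUB : measurable (\bigcup_n B n : set R) by exact: bigcupT_measurable.
  by rewrite UE; apply: le_measure; rewrite ?inE.
have cvgU : (nu (U n) @[n --> \oo] --> nu (\bigcup_n U n))%E.
  apply: nondecreasing_cvg_mu => //; first by rewrite UE; exact: bigcupT_measurable.
  apply/nondecreasing_seqP => n; apply/subsetPset.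
  by rewrite [X in _ `<=` X]/U big_ord_recr/=; exact: subsetUl.
rewrite -(cvg_lim _ cvgU)//; apply: lime_le; first by apply/cvg_ex; eexists; exact: cvgU.
apply: nearW => n; apply: H.
  apply: bigsetU_measurable => k _; apply: sub_gen_smallest; exact: mB.
apply: le_lt_trans Bd; apply: (@le_trans _ _ (\sum_(k < n.+1) mu (B k))%E).
  apply: (@content_subadditive _ _ _ mu (U n) (fun k => B k : set R)).
  - by move=> k _; exact: mB'.
  - exact: mU.
  - by [].
rewrite (eq_bigr (fun k : 'I_n.+1 => wlength idfun (B k))); last first.
  move=> k _; rewrite /lebesgue_measure /lebesgue_stieltjes_measure.
  by rewrite /measure_extension/= measurable_mu_extE.
rewrite -(big_mkord xpredT (fun k => wlength idfun (B k))).
exact: nneseries_lim_ge.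
Qed.

(** The Radon-Nikodym density of [nu] on []a, b]] serves as [h], because [nu] gives []a, x]] the
    mass [F x - F a]. *)
Lemma nondecreasing_abs_cont_integral : exists2 h : R -> R,
  mu.-integrable setT (EFin \o h) &
  {in `[a, b], forall x, F x = F a + \int[mu]_(t in `]a, x]) h t}.
Proof.
have Gid x : a <= x -> x <= b -> G x = F x by move=> ax xb; rewrite /G/= clamp_id.
have mab : measurable (`]a, b]%classic : set (measurableTypeR R)).
  exact: measurable_itv.
have nuab : (nu `]a, b]%classic < +oo)%E.
  by rewrite lebesgue_stieltjes_measure_oc ?ltry.
(* Restricted to []a, b]], the measure is finite, as the form of the Radon-Nikodym theorem used
   below asks. *)
pose nu' : {finite_measure set (measurableTypeR R) -> \bar R} := mfrestr mab nuab.
have nu'mu : nu' `<< mu.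
  apply/null_content_dominatesP => A mA muA0; rewrite /nu'/= /mfrestr /mrestr.
  have /null_content_dominatesP := stieltjes_dominated; apply.
    exact: measurableI.
  by apply/eqP; rewrite -measure_le0 -muA0 le_measure ?inE//; exact: measurableI.
have [g [g0 gfin intg gE]] := radon_nikodym_sigma_finite nu'mu.
exists (fine \o g).
  by apply: eq_integrable intg => // x _ /=; rewrite fineK.
move=> x /[!in_itv]/= /andP[ax xb].
have mx : measurable (`]a, x]%classic : set R) by exact: measurable_itv.
rewrite /Rintegral (eq_integral g) => [|y _]; last by rewrite /= fineK.
rewrite -gE// /nu'/= /mfrestr /mrestr setIidl; last first.
  by apply: subset_itvl; rewrite bnd_simp.
by rewrite lebesgue_stieltjes_measure_oc//= !Gid//= addrC subrK.
Qed.

End nondecreasing.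

(** [f] is the difference of the nondecreasing functions [f + T] and [T], and the densities are
    subtracted accordingly. Truncating to []a, b]] lets later integrals run over the whole line. *)
Lemma abs_cont_integral a b f : a <= b -> abs_cont a b f -> exists h : R -> R,
  [/\ mu.-integrable setT (EFin \o h),
      forall x, x \notin `]a, b] -> h x = 0 &
      {in `[a, b], forall x, f x = f a + \int[mu]_(t in `]a, x]) h t}].
Proof.
move=> ab acf; pose T := variation_function a f.
have acT : abs_cont a b T by exact: abs_cont_variation_function.
have ndT : {in `[a, b] &, {homo T : x y / x <= y}}.
  move=> x y /[!in_itv]/= /andP[ax xb] /andP[ay yb] xy.
  rewrite -subr_ge0; apply: le_trans (le_norm_variation_functionB acf ax xy yb).
  exact: normr_ge0.
have ndfT : {in `[a, b] &, {homo (f \+ T) : x y / x <= y}}.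
  move=> x y /[!in_itv]/= /andP[ax xb] /andP[ay yb] xy.
  have := le_norm_variation_functionB acf ax xy yb; rewrite ler_norml -/T.
  by move=> /andP[]; lra.
have [h1 ih1 h1E] := nondecreasing_abs_cont_integral ab (abs_contD acf acT) ndfT.
have [h2 ih2 h2E] := nondecreasing_abs_cont_integral ab acT ndT.
pose h := (h1 \- h2) \_ `]a, b].
have ih : mu.-integrable setT (EFin \o (h1 \- h2)).
  by rewrite (_ : _ \o _ = (EFin \o h1) \- (EFin \o h2))%E//; exact: integrableB.
exists h; split.
- rewrite /h -restrict_EFin; apply/integrable_restrict => //=.
  by rewrite setTI; apply: integrableS ih.
- by move=> x xab; rewrite /h patchE; case: ifPn => //; rewrite inE/= (negPf xab).
- move=> x xab; have := xab; rewrite in_itv/= => /andP[ax xb].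
  have xS : `]a, x] `<=` `]a, b] by apply: subset_itvl; rewrite bnd_simp.
  have -> : \int[mu]_(t in `]a, x]) h t = \int[mu]_(t in `]a, x]) (h1 t - h2 t).
    by apply: eq_Rintegral => t /[!inE] /xS tab; rewrite /h patchE mem_set.
  rewrite RintegralB//; [|exact: integrableS ih1|exact: integrableS ih2].
  by have := h1E x xab; have := h2E x xab; rewrite /=; lra.
Qed.

End stieltjes.

(** * Integrals of almost everywhere equal functions *)

Section ae_eq.
Context {d : measure_display} {T : measurableType d} {R : realType}.
Variable m : {measure set T -> \bar R}.
Import HBNNSimple.

(** Setting a simple function to 0 on the null set [N] preserves its integral and makes it a
    competitor below [g]. *)
Let le_nnintegral (f g : T -> \bar R) (N : set T) : measurable N -> m N = 0%E ->
  (forall x, (0 <= g x)%E) -> (forall x, ~ N x -> f x = g x) ->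
  (ereal_sup [set sintegral m h |
     h in [set h : {nnsfun T >-> R} | forall x, ((h x)%:E <= f x)%E]] <=
   ereal_sup [set sintegral m h |
     h in [set h : {nnsfun T >-> R} | forall x, ((h x)%:E <= g x)%E]])%E.
Proof.
move=> mN N0 g0 fg; apply: ge_ereal_sup => _ [h hf <-]; apply: ereal_sup_ubound.
exists (proj_nnsfun h (measurableC mN)).
  move=> x; rewrite -mrestrict patchE; case: ifPn => [|_]; last exact: g0.
  by rewrite inE => Nx; rewrite -fg.
rewrite -[LHS]integralT_nnsfun -[RHS]integralT_nnsfun; apply: ae_eq_integral => //.
- exact/measurable_EFinP/measurable_funTS.
- exact/measurable_EFinP/measurable_funTS.
- exists N; split => // x /=; apply: contra_notP => Nx _.
  by rewrite mindicE mem_set ?mulr1.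
Qed.

(* The usual measurability hypotheses are avoided because f^`() need not be
   Borel measurable on the exceptional null set. *)
Lemma ae_eq_integral_nonmeasurable (D : set T) (f g : T -> \bar R) :
  ae_eq m D f g -> (\int[m]_(x in D) f x = \int[m]_(x in D) g x)%E.
Proof.
move=> [N [mN N0 fgN]]; have fg x : ~ N x -> (f \_ D) x = (g \_ D) x.
  move=> Nx; rewrite !patchE; case: ifPn => // /[!inE] Dx.
  by apply: contrapT => fgx; apply/Nx/fgN => /(_ Dx).
rewrite /integral; congr (_ - _)%E; apply/eqP; rewrite eq_le; apply/andP; split;
  apply: (@le_nnintegral _ _ N) => // x Nx;
    by rewrite ?funeposE ?funenegE fg.
Qed.

Lemma ae_eq_Rintegral (D : set T) (f g : T -> R) :
  ae_eq m D f g -> \int[m]_(x in D) f x = \int[m]_(x in D) g x.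
Proof.
move=> fg; congr fine; apply: ae_eq_integral_nonmeasurable.
by apply: filterS fg => x /= fgx Dx; rewrite fgx.
Qed.

End ae_eq.

(** * Invariance of Lebesgue measure under reflections *)

Section reflection.
Variable R : realType.
Local Notation mu := (@lebesgue_measure R).
Implicit Types (c : R).

Definition reflection c (x : measurableTypeR R) : measurableTypeR R := c - x.

Let measurable_reflection c : measurable_fun setT (reflection c).
Proof.
have : measurable_fun [set: R] (fun x => c - x) by exact: measurable_funB.
exact.
Qed.

HB.instance Definition _ c :=
  isMeasurableFun.Build _ _ _ _ (reflection c) (@measurable_reflection c).

(** Lebesgue measure is determined by its values on the intervals []u, v]]; such an interval pulls
    back to [[c - v, c - u[], of the same length. *)
Lemma lebesgue_measure_reflection c (A : set R) : measurable A ->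
  pushforward mu (reflection c) A = mu A.
Proof.
move=> mA; apply/esym/lebesgue_measure_unique => //= _ [[u v] _ <-].
rewrite /pushforward/=; apply/esym.
transitivity (mu `[c - v, c - u[%classic).
  have E (z : R) : (u < c - z <= v) = (c - v <= z < c - u).
    by apply/idP/idP => /andP[? ?]; apply/andP; split; lra.
  by congr (mu _); apply/seteqP; split => z /=; rewrite !in_itv/= /reflection E.
rewrite !lebesgue_measure_itv/= !lte_fin ltrD2l ltrN2.
by case: ifP => // _; rewrite -!EFinB; congr EFin; lra.
Qed.

Lemma ge0_integral_reflection c (g : R -> \bar R) : measurable_fun setT g ->
  (forall x, (0 <= g x)%E) ->
  (\int[mu]_x g (c - x)%R = \int[mu]_x g x)%E.
Proof.
move=> mg g0; transitivity (\int[pushforward mu (reflection c)]_x g x)%E.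
  by rewrite ge0_integral_pushforward.
by apply: eq_measure_integral => A mA _; exact: lebesgue_measure_reflection.
Qed.

Lemma integrable_reflection c (g : R -> \bar R) : mu.-integrable setT g ->
  mu.-integrable setT (fun x => g (c - x)).
Proof.
move=> /integrableP[mg ig]; apply/integrableP; split.
  exact: measurableT_comp mg (@measurable_reflection c).
rewrite (@ge0_integral_reflection c (fun x => `|g x|)%E)//.
exact: measurableT_comp.
Qed.

Lemma integral_reflection c (g : R -> \bar R) : mu.-integrable setT g ->
  (\int[mu]_x g (c - x)%R = \int[mu]_x g x)%E.
Proof.
move=> ig; rewrite integralE [RHS]integralE.
have mg : measurable_fun setT g by exact: measurable_int ig.
congr (_ - _)%E.
  rewrite -(@ge0_integral_reflection c (g^\+)%E)//; last exact: measurable_funepos.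
  by apply: eq_integral => x _; rewrite !funeposE.
rewrite -(@ge0_integral_reflection c (g^\-)%E)//; last exact: measurable_funeneg.
by apply: eq_integral => x _; rewrite !funenegE.
Qed.

(** A translation is the composite of the reflections [x |-> c - x] and [x |-> 0 - x]. *)
Lemma integrable_translation c (g : R -> \bar R) : mu.-integrable setT g ->
  mu.-integrable setT (fun x => g (x - c)).
Proof.
move=> ig.
have := integrable_reflection c (integrable_reflection 0 ig).
by apply: eq_integrable => // x _ /=; rewrite sub0r opprB.
Qed.

End reflection.

(** * Fubini's theorem for an integrable kernel and the tails of an integrable function *)

Section tail_convolution.
Variable R : realType.
Local Notation mu := (@lebesgue_measure R).
Variables K h : R -> R.
Hypotheses (iK : mu.-integrable setT (EFin \o K))
  (ih : mu.-integrable setT (EFin \o h)).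

Let mK : measurable_fun setT K.
Proof. by apply/measurable_EFinP; exact: measurable_int iK. Qed.

Let mh : measurable_fun setT h.
Proof. by apply/measurable_EFinP; exact: measurable_int ih. Qed.

(** By Tonelli's theorem one may integrate in the first variable first, which leaves at most [C]
    times the integral of [|h|]. *)
Lemma integrable_prod_weight (phi : R * R -> R) (C : R) :
  measurable_fun setT phi ->
  (forall y, (\int[mu]_x `|phi (x, y)|%:E <= C%:E)%E) ->
  (mu \x mu)%E.-integrable setT (fun p => (phi p * h p.2)%:E).
Proof.
move=> mphi phiC; have mhp : measurable_fun setT (fun p : R * R => h p.2).
  exact: measurableT_comp mh measurable_snd.
apply/integrable21ltyP.
  by apply/measurable_EFinP; exact: measurable_funM mphi mhp.
have /integrableP[_ hoo] := ih.
have C0 : (0 <= C%:E)%E by apply: le_trans (phiC 0); exact: integral_ge0.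
have mah : measurable_fun setT (fun y => `|(h y)%:E|%E).
  by apply: measurableT_comp => //; exact/measurable_EFinP.
apply: (@le_lt_trans _ _ (\int[mu]_y (C%:E * `|(h y)%:E|))%E); last first.
  by rewrite ge0_integralZl_EFin// lte_mul_pinfty.
have mphiy y : measurable_fun setT (fun x => phi (x, y)).
  exact: measurableT_comp mphi (measurable_pair2 _).
apply: ge0_le_integral => //.
- move=> y _; exact: integral_ge0.
- apply: (measurable_fun_fubini_tonelli_G (m1 := mu)
    (fun p : R * R => `|(phi p * h p.2)%:E|%E)) => //.
  by apply: measurableT_comp => //; apply/measurable_EFinP; exact: measurable_funM.
- exact: measurable_funeM.
move=> y _.
have -> : (\int[mu]_x `|(phi (x, y) * h y)%:E| =
    \int[mu]_x (`|h y|%:E * `|phi (x, y)|%:E))%E.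
  by apply: eq_integral => x _; rewrite /= normrM mulrC.
rewrite ge0_integralZl_EFin//; last first.
  apply/measurable_EFinP.
  exact: (measurableT_comp (@normr_measurable R setT) (mphiy y)).
by rewrite muleC; apply: lee_wpmul2r => //; rewrite lee_fin.
Qed.

Let k : R := fine (\int[mu]_x `|(K x)%:E|)%E.

Let kE : (\int[mu]_x `|(K x)%:E| = k%:E)%E.
Proof.
have /integrableP[_ Koo] := iK.
by rewrite fineK// ge0_fin_numE// integral_ge0.
Qed.

Let maK : measurable_fun setT (fun x => `|(K x)%:E|%E).
Proof. by apply: measurableT_comp => //; exact/measurable_EFinP. Qed.

Let integral_shear y : (\int[mu]_x `|K (y - x)|%:E = k%:E)%E.
Proof. by rewrite -kE -(ge0_integral_reflection y maK). Qed.

Let integral_shift x : (\int[mu]_t `|K (t - x)|%:E = k%:E)%E.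
Proof.
rewrite -(integral_shear 0).
rewrite -(@ge0_integral_reflection _ x (fun s => `|K (0 - s)|%:E)%E)//.
  by apply: eq_integral => t _; rewrite sub0r opprB.
apply/measurable_EFinP; apply: measurableT_comp => //; apply: measurableT_comp => //.
exact: measurable_funB.
Qed.

Let le_integral_if (b : R -> bool) (g : R -> R) : measurable_fun setT b ->
  measurable_fun setT g ->
  (\int[mu]_x `|if b x then g x else 0|%:E <= \int[mu]_x `|g x|%:E)%E.
Proof.
move=> mb mg; apply: ge0_le_integral => //.
- apply/measurable_EFinP; apply: measurableT_comp => //.
  exact: measurable_fun_ifT.
- by apply/measurable_EFinP; exact: measurableT_comp.
- by move=> x _; rewrite lee_fin; case: ifP => // _; rewrite normr0.
Qed.

Let measurable_shear : measurable_fun setT (fun p : R * R => K (p.2 - p.1)).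
Proof. by apply: measurableT_comp => //; exact: measurable_funB. Qed.

Let measurable_shift x : measurable_fun setT (fun p : R * R => K (p.1 - x)).
Proof. by apply: measurableT_comp => //; exact: measurable_funB. Qed.

Let shear : R * R -> \bar R := fun p => (K (p.2 - p.1) * h p.2)%:E.

Let integrable_shear : (mu \x mu)%E.-integrable setT shear.
Proof.
by apply: (@integrable_prod_weight _ k) => // y; rewrite integral_shear.
Qed.

(** Integrands of the two double integrals to be compared: the conditionals here and in [cut_shift]
    encode the domains [x <= s] and [t <= y]. *)
Let cut_shear x : R * R -> \bar R :=
  fun p => ((if x <= p.1 then K (p.2 - p.1) else 0) * h p.2)%:E.

Let cut_shift x : R * R -> \bar R :=
  fun p => ((if p.1 <= p.2 then K (p.1 - x) else 0) * h p.2)%:E.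

Let integrable_cut_shear x : (mu \x mu)%E.-integrable setT (cut_shear x).
Proof.
apply: (@integrable_prod_weight _ k) => [|y].
  by apply: measurable_fun_ifT => //; exact: measurable_fun_ler.
rewrite -(integral_shear y).
apply: (@le_integral_if (fun s => x <= s) (fun s => K (y - s))).
  by apply: measurable_fun_ler; [exact: measurable_cst|exact: measurable_id].
by apply: measurableT_comp => //; exact: measurable_funB.
Qed.

Let integrable_cut_shift x : (mu \x mu)%E.-integrable setT (cut_shift x).
Proof.
apply: (@integrable_prod_weight _ k) => [|y].
  by apply: measurable_fun_ifT => //; exact: measurable_fun_ler.
rewrite -(integral_shift x).
apply: (@le_integral_if (fun t => t <= y) (fun t => K (t - x))).
  by apply: measurable_fun_ler; [exact: measurable_id|exact: measurable_cst].
by apply: measurableT_comp => //; exact: measurable_funB.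
Qed.

(** The substitution [s = x + y - t] exchanges [y - s] with [t - x] and the condition [x <= s] with
    [t <= y]. *)
Let integral_cut x y :
  (\int[mu]_t cut_shift x (t, y) = \int[mu]_s cut_shear x (s, y))%E.
Proof.
rewrite -[RHS](integral_reflection (x + y)); last first.
  have iKy : mu.-integrable setT (fun s => (h y)%:E * (K (y - s))%:E)%E.
    exact/integrableZl/(integrable_reflection y iK).
  have mg : measurable_fun setT (fun s => (if x <= s then K (y - s) else 0) * h y).
    apply: measurable_funM => //; apply: measurable_fun_ifT => //.
      by apply: measurable_fun_ler; [exact: measurable_cst|exact: measurable_id].
    by apply: measurableT_comp => //; exact: measurable_funB.
  apply: le_integrable iKy => // [|s _]; first exact/measurable_EFinP.
  rewrite lee_fin /cut_shear/= mulrC !normrM ler_wpM2l//.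
  by case: ifP; rewrite ?normr0.
apply: eq_integral => t _; rewrite /cut_shift /cut_shear/=.
have E : (x <= x + y - t) = (t <= y) by rewrite -addrA lerDl subr_ge0.
rewrite -E; case: ifP => // _; congr (K _ * _)%:E; lra.
Qed.

Let tail t : R := \int[mu]_(y in `[t, +oo[) h y.

Let tailE t : (\int[mu]_y (if t <= y then h y else 0)%:E)%E = (tail t)%:E.
Proof.
rewrite /tail /Rintegral fineK; last first.
  by apply: integrable_fin_num => //; exact: integrableS ih.
rewrite [RHS]integral_mkcond; apply: eq_integral => y _.
by rewrite patchE mem_setE in_itv/= andbT; case: ifP.
Qed.

Let integral_cut_shift x t :
  (\int[mu]_y cut_shift x (t, y) = (K (t - x) * tail t)%:E)%E.
Proof.
rewrite EFinM -tailE -integralZl//; last first.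
  have mg : measurable_fun setT (fun y => if t <= y then h y else 0).
    apply: measurable_fun_ifT => //.
    by apply: measurable_fun_ler; [exact: measurable_cst|exact: measurable_id].
  apply: le_integrable ih => // [|y _]; first exact/measurable_EFinP.
  by rewrite lee_fin/=; case: ifP => // _; rewrite normr0.
apply: eq_integral => y _; rewrite /cut_shift/= -EFinM.
by case: ifP; rewrite ?(mul0r, mulr0).
Qed.

Lemma integrable_shift_tail x :
  mu.-integrable setT (fun t => (K (t - x) * \int[mu]_(y in `[t, +oo[) h y)%:E).
Proof.
have := integrable_fubini_F (integrable_cut_shift x).
by apply: eq_integrable => // t _; exact: integral_cut_shift.
Qed.

(** The transpose of the operator of convolution by [K], applied to [h]. *)
Definition convolution_adjoint s : R := \int[mu]_y (K (y - s) * h y).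

Let fubini_shear s := (\int[mu]_y shear (s, y))%E.

Let integrable_fubini_shear : mu.-integrable setT fubini_shear.
Proof. exact: integrable_fubini_F integrable_shear. Qed.

Lemma integrable_convolution_adjoint :
  mu.-integrable setT (EFin \o convolution_adjoint).
Proof.
apply: le_integrable integrable_fubini_shear => //.
  apply/measurable_EFinP; apply: measurableT_comp => //.
  exact: measurable_int integrable_fubini_shear.
move=> s _; rewrite /= /convolution_adjoint /Rintegral -/(fubini_shear s).
(* Where [fubini_shear] is infinite, [fine] returns 0 and the bound is trivial. *)
by case: fubini_shear => //=; rewrite normr0 leey.
Qed.

(** Fubini's theorem is used twice: to bring the integral in [t] inside, where [integral_cut]
    replaces it at fixed [y], and to bring the new variable [s] back outside. *)
Lemma integral_shift_tail x :
  \int[mu]_t (K (t - x) * \int[mu]_(y in `[t, +oo[) h y) =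
  \int[mu]_(s in `[x, +oo[) convolution_adjoint s.
Proof.
rewrite /Rintegral; congr fine.
transitivity (\int[mu]_t \int[mu]_y cut_shift x (t, y))%E.
  by apply: eq_integral => t _; rewrite integral_cut_shift.
rewrite (Fubini (integrable_cut_shift x)).
transitivity (\int[mu]_y \int[mu]_s cut_shear x (s, y))%E.
  by apply: eq_integral => y _; exact: integral_cut.
rewrite -(Fubini (integrable_cut_shear x)) [RHS]integral_mkcond.
transitivity (\int[mu]_s (fubini_shear \_ `[x, +oo[) s)%E.
  apply: eq_integral => s _; rewrite patchE mem_setE in_itv/= andbT /cut_shear/=.
  case: ifP => // _; under eq_integral do rewrite mul0r.
  exact: integral0.
(* The inner integral is known to be finite only for almost every [s], so [fine] is removed almost
   everywhere. *)
apply: ae_eq_integral_nonmeasurable.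
apply: filterS (integrable_ae measurableT integrable_fubini_shear) => s /(_ I) sfin _.
by rewrite !patchE; case: ifP => // _; rewrite /= fineK.
Qed.

End tail_convolution.

(** * Tails of an integrable function as primitives *)

Section primitive.
Variable R : realType.
Local Notation mu := (@lebesgue_measure R).
Variable g : R -> R.
Hypothesis ig : mu.-integrable setT (EFin \o g).

Lemma Rintegral_tailE x : \int[mu]_(t in `[x, +oo[) g t =
  \int[mu]_t g t - \int[mu]_(t in `]-oo, x]) g t.
Proof.
rewrite -Rintegral_itv_obnd_cbnd; last exact: integrableS ig.
rewrite -(@Rintegral_itvB _ _ -oo%O +oo%O) ?set_itvNyy//.
Qed.

(** The Lebesgue differentiation theorem applies to the primitive from [-oo], and the tail is a
    constant minus this primitive. *)
Lemma ae_is_derive_tail :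
  {ae mu, forall x : R,
    is_derive x (1 : R) (fun z : R => \int[mu]_(t in `[z, +oo[) g t) (- g x)}.
Proof.
have ig' (y : R) : mu.-integrable `]-oo, y] (EFin \o g) by exact: integrableS ig.
have lg : locally_integrable setT g.
  by apply: open_integrable_locally => //; exact: openT.
have := FTC1Ny ig' lg.
apply: filterS; first exact: (ae_filter_ringOfSetsType mu).
move=> x [dP P'x].
rewrite (funext Rintegral_tailE).
have Px : is_derive x (1 : R) (fun z : R => \int[mu]_(t in `]-oo, z]) g t) (g x).
  by apply: DeriveDef => //; rewrite -derive1E.
by rewrite -[- g x]add0r; apply: is_deriveB.
Qed.

(** The union [A] of the intervals has the sum of their lengths as its measure, so the integral of
    [|g|] over [A] is small by absolute continuity of the integral. *)
Lemma Rintegral_tail_absolutely_continuous a b :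
  absolutely_continuous_on a b (fun x => \int[mu]_(t in `[x, +oo[) g t).
Proof.
have mg (A : set R) : measurable_fun A g.
  by apply: measurable_funTS; apply/measurable_EFinP; exact: measurable_int ig.
move=> e e0; have [d [d0 H]] := integral_normr_continuous ig e0.
exists d => // n u v uv tuv luv.
pose I i : set R := `]u i, v i[%classic.
pose A := \big[setU/set0]_(i < n) I i.
have mI i : measurable (I i) by exact: measurable_itv.
have mA : measurable A by exact: bigsetU_measurable.
have muA : mu A = (\sum_(i < n) (v i - u i))%:E.
  rewrite /A measure_semi_additive_ord// -sumEFin; apply: eq_bigr => i _.
  rewrite [LHS](lebesgue_measure_itv `]u i, v i[)/= lte_fin -EFinB; case: ltP => // vu.
  have [_ uvi _] := uv i; congr EFin; apply/esym/eqP; rewrite subr_eq0.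
  by rewrite eq_le vu uvi.
have luA : (mu A < d%:E)%E by rewrite muA lte_fin.
have := H A mA luA; apply: le_lt_trans.
have intI i : mu.-integrable (I i) (EFin \o g).
  by apply: integrableS ig => //; exact: mI.
have absI i : mu.-integrable (I i) (fun x => `|g x|%:E).
  exact: (integrable_abse (intI i)).
have -> : \int[mu]_(x in A) `|g x| = \sum_(i < n) \int[mu]_(x in I i) `|g x|.
  rewrite /Rintegral ge0_integral_bigsetU ?index_enum_uniq//.
  - rewrite sum_fine//= => i _; apply: integrable_fin_num => //; exact: mI.
  - exact: sub_trivIset tuv.
  - apply/measurable_EFinP.
    exact: (measurableT_comp (@normr_measurable R setT) (mg _)).
apply: ler_sum => i _; have [_ uvi _] := uv i.
(* The increment of the tail is minus the integral over []u i, v i]], whose right end has measure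
   zero. *)
rewrite !Rintegral_tailE opprB addrC addrA subrK.
have leI : `|\int[mu]_(t in I i) g t| <= \int[mu]_(t in I i) `|g t|.
  by apply: le_normr_Rintegral; [exact: mI|exact: intI].
apply: le_trans leI.
rewrite distrC Rintegral_itvB//; last exact: integrableS ig.
rewrite -Rintegral_itv_bndo_bndc//; exact: integrableS ig.
Qed.

End primitive.

(** * Uniqueness of the absolutely continuous representative *)

Section uniqueness.
Variable R : realType.
Local Notation mu := (@lebesgue_measure R).
Implicit Types (a b x : R) (f g : R -> R).

Lemma absolutely_continuous_on_continuous a b f x :
  absolutely_continuous_on a b f -> a < x -> x < b -> {for x, continuous f}.
Proof.
move=> /absolutely_continuous_on_abs_cont acf ax xb.
apply/cvgrPdist_lt => e e0; have [d d0 H] := acf e e0.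
(* Points within [r] of [x] stay in [[a, b]] and bound with [x] an interval shorter than [d]. *)
pose r := Num.min (Num.min (x - a) (b - x)) d.
have r0 : 0 < r by rewrite !lt_min d0 !subr_gt0 ax xb.
near=> y; have xyr : `|x - y| < r by near: y; apply/nbhs_ballP; exists r.
have [ay yb xyd yxd] : [/\ a <= y, y <= b, x - y < d & y - x < d].
  move: xyr; rewrite !lt_min !ltr_norml.
  by move=> /andP[/andP[/andP[? ?] /andP[? ?]] /andP[? ?]]; split; lra.
have [xy|yx] := leP x y.
  rewrite distrC; have := H [:: (x, y)].
  rewrite /nonoverlapping_family /total_length/= !big_seq1/=; apply => //.
  by rewrite xy yb ltW.
have := H [:: (y, x)].
rewrite /nonoverlapping_family /total_length/= !big_seq1/=; apply => //.
by rewrite ay !ltW.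
Unshelve. all: by end_near. Qed.

(** Otherwise the difference, continuous at [x], would be nonzero on a ball inside [[a, b]]; such a
    ball has positive measure and cannot lie in a null set. *)
Lemma ae_eq_continuous_eq a b f g x :
  absolutely_continuous_on a b f -> absolutely_continuous_on a b g ->
  ae_eq mu `[a, b]%classic f g -> a < x -> x < b -> f x = g x.
Proof.
move=> acf acg [N [mN N0 fgN]] ax xb.
apply/eqP; rewrite -subr_eq0; apply/negPn/negP => fgx.
have c : {for x, continuous (fun y => f y - g y)}.
  by apply: continuousB; apply: absolutely_continuous_on_continuous; eassumption.
have /nbhs_ballP[r /= r0 rP] : \forall y \near x, f y - g y != 0.
  exact: (cvgr_neq0 _ c).
pose s := Num.min r (Num.min (x - a) (b - x)).
have s0 : 0 < s by rewrite !lt_min r0 !subr_gt0 ax xb.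
have sN : ball x s `<=` N.
  move=> y; rewrite /ball/= !lt_min => /andP[xyr].
  rewrite !ltr_norml => /andP[/andP[? ?] /andP[? ?]].
  apply: fgN => /= /(_ _)/eqP; rewrite -subr_eq0 => fgy.
  have /negP := rP y xyr; apply; apply: fgy.
  by rewrite in_itv/=; apply/andP; split; lra.
have : (mu (ball x s) <= mu N)%E.
  apply: le_measure => //; rewrite inE; [exact: measurable_ball|exact: mN].
rewrite N0 lebesgue_measure_ball; last exact: ltW.
by rewrite lee_fin leNgt pmulrn_lgt0// s0.
Qed.

End uniqueness.

(** * Integrability of the exponential integral kernel *)

Lemma measurable_invr (R : realType) : measurable_fun [set: R] (@GRing.inv R).
Proof.
rewrite -(setvU [set 0]); apply/measurable_funU => //.
  exact: measurableC.
split; last exact: measurable_fun_set1.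
apply: open_continuous_measurable_fun.
  by rewrite openC; exact: closed_eq.
by move=> x /[!inE]/= x0; apply: inv_continuous; apply/eqP.
Qed.

Section E1_kernel.
Variables (R : realType) (alpha : R).
Hypothesis alpha_gt0 : 0 < alpha.
Local Notation mu := (@lebesgue_measure R).

(** Extension by 0 to negative arguments turns integrals starting at [x] into integrals over the
    line. *)
Definition E1_kernel (s : R) : R := if 0 <= s then alpha^-1 * E1 (s / alpha) else 0.

Lemma E1_kernel_nneg s : 0 <= s -> E1_kernel s = alpha^-1 * E1 (s / alpha).
Proof. by rewrite /E1_kernel => ->. Qed.

Lemma E1_kernel_neg s : s < 0 -> E1_kernel s = 0.
Proof. by rewrite /E1_kernel ltNge => /negbTE ->. Qed.

(** A nonnegative function of two variables whose integral in the second one yields [E1], so that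
    Tonelli's theorem applies. *)
Let density (p : R * R) : R :=
  if (0 <= p.1) && (p.1 / alpha <= p.2) then expR (- p.2) / p.2 else 0.

Let measurable_density : measurable_fun setT density.
Proof.
have m1 : measurable_fun setT (fun p : R * R => p.1) by exact: measurable_fst.
have m2 : measurable_fun setT (fun p : R * R => p.2) by exact: measurable_snd.
apply: measurable_fun_ifT => //.
- apply: measurable_and; first exact: measurable_fun_ler.
  by apply: measurable_fun_ler => //; exact: measurable_funM.
- apply: measurable_funM.
    by apply: measurableT_comp => //; exact: measurableT_comp.
  exact: (measurableT_comp (@measurable_invr R) m2).
Qed.

Let density_ge0 p : 0 <= density p.
Proof.
rewrite /density; case: ifP => // /andP[p1 p12].
by rewrite divr_ge0 ?expR_ge0// (le_trans _ p12)// divr_ge0// ltW.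
Qed.

Let Kd (s : R) : \bar R := (\int[mu]_t (density (s, t))%:E)%E.

Let E1_kernelE s : E1_kernel s = alpha^-1 * fine (Kd s).
Proof.
rewrite /E1_kernel /Kd /density/=; case: ifP => [s0|_] /=; last first.
  by rewrite integral0/= mulr0.
congr (_ * fine _); rewrite integral_mkcond; apply: eq_integral => t _.
by rewrite patchE mem_setE in_itv/= andbT; case: ifP.
Qed.

Let measurable_Kd : measurable_fun setT Kd.
Proof.
apply: (measurable_fun_fubini_tonelli_F (m2 := mu) (EFin \o density)) => //.
  exact/measurable_EFinP.
Qed.

Let Kd_ge0 s : (0 <= Kd s)%E.
Proof. by apply: integral_ge0 => t _; rewrite lee_fin. Qed.

(** For [t > 0] the integrand is the constant [expR (- t) / t] on [[0, t * alpha]], so the integral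
    is [alpha * expR (- t)], a multiple of the exponential density of rate 1. *)
Let integral_density t : (\int[mu]_s (density (s, t))%:E <=
  alpha%:E * (exponential_pdf 1 t)%:E)%E.
Proof.
rewrite /density/=; have [t0|t0] := ltP t 0.
  rewrite integral0_eq ?mule_ge0 ?lee_fin ?exponential_pdf_ge0 ?(ltW alpha_gt0)//.
  move=> s _; case: ifP => // /andP[s0 st].
  by have := le_lt_trans st t0; rewrite ltNge divr_ge0// ltW.
have -> : (\int[mu]_s (if (0 <= s) && (s / alpha <= t) then expR (- t) / t else 0)%R%:E =
    \int[mu]_(s in `[0%R, (t * alpha)%R]) (cst (expR (- t) / t)%R%:E s))%E.
  rewrite [RHS]integral_mkcond; apply: eq_integral => s _.
  by rewrite patchE mem_setE in_itv/= ler_pdivrMr//; case: ifP.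
rewrite integral_cst//.
have /= -> := lebesgue_measure_itv `[0, t * alpha]; rewrite lte_fin.
rewrite exponential_pdfE//= mulN1r mul1r.
case: ifP => [ta|_]; last first.
  by rewrite mule0 -EFinM lee_fin mulr_ge0 ?expR_ge0// ltW.
rewrite sube0 -!EFinM lee_fin mulrA.
have tn0 : t != 0 by apply: contraTneq ta => ->; rewrite mul0r ltxx.
by rewrite divfK// mulrC.
Qed.

(** When [s] is integrated first, the total mass of [Kd] is at most [alpha] times that of an
    exponential density, which is 1. *)
Lemma integrable_E1_kernel : mu.-integrable setT (EFin \o E1_kernel).
Proof.
have iKd : mu.-integrable setT Kd.
  apply/integrableP; split => //.
  under eq_integral do rewrite gee0_abs//.
  rewrite /Kd (fubini_tonelli (m1 := mu) (m2 := mu) (EFin \o density))/=; last 2 first.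
  - exact/measurable_EFinP.
  - by move=> p; rewrite lee_fin.
  apply: (@le_lt_trans _ _ (\int[mu]_t (alpha%:E * (exponential_pdf 1 t)%:E))%E).
    apply: ge0_le_integral => //.
    - by move=> t _; apply: integral_ge0 => s _; rewrite lee_fin.
    - apply: (measurable_fun_fubini_tonelli_G (m1 := mu) (EFin \o density)).
        exact/measurable_EFinP.
      by move=> p; rewrite lee_fin.
    - apply: measurable_funeM; apply/measurable_EFinP.
      exact: measurable_exponential_pdf.
  rewrite integralZl//; last exact: integrable_exponential_pdf.
  by rewrite integral_exponential_pdf// mule1 ltry.
apply: le_integrable (integrableZl measurableT alpha^-1 iKd) => //.
  apply/measurable_EFinP; rewrite (funext E1_kernelE); apply: measurable_funM => //.
  exact: measurableT_comp.
move=> s _; rewrite /= E1_kernelE normrM EFinM abseM; apply: lee_pmul => //.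
(* [Kd] is infinite at [s = 0], where [fine] returns 0. *)
by case: (Kd s) => //=; rewrite normr0 leey.
Qed.

End E1_kernel.

(** * The right-sided fractional integral of an absolutely continuous function *)

Lemma integrable_if (R : realType) (c : R -> bool) (g : R -> R) :
  measurable_fun setT c ->
  (@lebesgue_measure R).-integrable setT (EFin \o g) ->
  (@lebesgue_measure R).-integrable setT (fun t => (if c t then g t else 0)%:E).
Proof.
move=> mc ig; have mg : measurable_fun setT (fun t => if c t then g t else 0).
  apply: measurable_fun_ifT => //; apply/measurable_EFinP.
  exact: measurable_int ig.
apply: le_integrable ig => // [|t _]; first exact/measurable_EFinP.
by rewrite lee_fin/=; case: ifP => // _; rewrite normr0.
Qed.

Section right_fractional_integral.
Variables (R : realType) (a b : R) (f : R -> R).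
Hypotheses (ab : a < b) (acf : absolutely_continuous_on a b f).
Local Notation mu := (@lebesgue_measure R).

(** As [h] vanishes beyond [b], its tail from [x] is its integral over [[x, b]], that is
    [f b - f x]. *)
Lemma absolutely_continuous_on_tail : exists h : R -> R,
  [/\ mu.-integrable setT (EFin \o h),
      forall x, x \notin `]a, b] -> h x = 0 &
      {in `[a, b], forall x, f x = f b - \int[mu]_(y in `[x, +oo[) h y}].
Proof.
have [h [ih h0 fh]] := abs_cont_integral (ltW ab) (absolutely_continuous_on_abs_cont acf).
exists h; split => // x xab; have := xab; rewrite in_itv/= => /andP[ax xb].
have bab : b \in `[a, b] by rewrite in_itv/= lexx ltW.
have -> : \int[mu]_(y in `[x, +oo[) h y = \int[mu]_(y in `[x, b]) h y.
  rewrite Rintegral_mkcond [RHS]Rintegral_mkcond; apply: eq_Rintegral => y _.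
  rewrite !patchE !mem_setE !in_itv/= andbT; case: (leP x y) => //= xy.
  by case: leP => // yb; rewrite h0// in_itv/= negb_and -ltNge yb orbT.
rewrite -Rintegral_itv_obnd_cbnd; last exact: integrableS ih.
rewrite -(@Rintegral_itvB _ _ (BRight a) (BRight b)) ?bnd_simp//; last first.
  exact: integrableS ih.
by rewrite (fh _ xab) (fh _ bab); lra.
Qed.

Variables (alpha : R) (h : R -> R).
Hypothesis alpha_gt0 : 0 < alpha.
Hypothesis ih : mu.-integrable setT (EFin \o h).
Hypothesis h0 : forall x, x \notin `]a, b] -> h x = 0.
Hypothesis fh : {in `[a, b], forall x, f x = f b - \int[mu]_(y in `[x, +oo[) h y}.

Local Notation K := (E1_kernel alpha).
Let iK := integrable_E1_kernel alpha_gt0.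

(** The opposite of the claimed derivative, with [h] in place of the derivative of [f]. *)
Definition fderiv_density s : R := f b * K (b - s) - convolution_adjoint K h s.

Lemma integrable_fderiv_density : mu.-integrable setT (EFin \o fderiv_density).
Proof.
apply: (@eq_integrable _ _ _ mu _ measurableT
    (fun s => (f b)%:E * (K (b - s))%:E - (convolution_adjoint K h s)%:E)%E) => //.
apply: integrableB => //; last exact: integrable_convolution_adjoint.
by apply: integrableZl => //; exact: (integrable_reflection b iK).
Qed.

Let integrable_cut_kernel x :
  mu.-integrable setT (fun t => (if t <= b then K (t - x) else 0)%:E).
Proof.
apply: (@integrable_if _ (fun t => t <= b) (fun t => K (t - x))).
  by apply: measurable_fun_ler; [exact: measurable_id|exact: measurable_cst].
exact: (integrable_translation x iK).
Qed.

(** The substitution of [integral_cut] with [b] in place of [y]; it serves the constant term [f b]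
    of [f]. *)
Lemma Rintegral_kernel_shift x :
  \int[mu]_t (if t <= b then K (t - x) else 0) =
  \int[mu]_(s in `[x, +oo[) K (b - s).
Proof.
rewrite [RHS]Rintegral_mkcond; congr fine.
transitivity (\int[mu]_s (if x <= s then K (b - s) else 0)%R%:E)%E; last first.
  by apply: eq_integral => s _; rewrite patchE mem_setE in_itv/= andbT.
rewrite -[RHS](integral_reflection (x + b)); last first.
  apply: (@integrable_if _ (fun s => x <= s) (fun s => K (b - s))).
    by apply: measurable_fun_ler; [exact: measurable_cst|exact: measurable_id].
  exact: (integrable_reflection b iK).
apply: eq_integral => t _.
have E : (x <= x + b - t) = (t <= b) by rewrite -addrA lerDl subr_ge0.
by rewrite -E; case: ifP => // _; congr (K _)%:E; lra.
Qed.

Let tail_eq0 t : b < t -> \int[mu]_(y in `[t, +oo[) h y = 0.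
Proof.
move=> bt; transitivity (\int[mu]_(y in `[t, +oo[) (0 : R)); last first.
  by rewrite /Rintegral integral0.
apply: eq_Rintegral => y; rewrite inE/= in_itv/= andbT => ty.
by rewrite h0// in_itv/= negb_and -ltNge (lt_le_trans bt ty) orbT.
Qed.

(** Inserting [fh] splits the integral into a constant term, treated by [Rintegral_kernel_shift],
    and a tail term, treated by [integral_shift_tail]. *)
Lemma right_fintE x : a <= x -> x <= b ->
  right_fint alpha b f x = \int[mu]_(s in `[x, +oo[) fderiv_density s.
Proof.
move=> ax xb; rewrite /right_fint.
have alphaN0 : alpha != 0 by rewrite gt_eqF.
(* [alpha * psi] is the integrand of [right_fint] extended by 0: [K] vanishes before [x], and beyond
   [b] both terms vanish. The factor [alpha] cancels the [alpha^-1] inside [K]. *)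
pose psi t := f b * (if t <= b then K (t - x) else 0) -
  K (t - x) * \int[mu]_(y in `[t, +oo[) h y.
have i1 := integrable_cut_kernel x.
have i1' : mu.-integrable setT
    (fun t => (f b * (if t <= b then K (t - x) else 0))%:E).
  exact: integrableZl i1.
have i2 := integrable_shift_tail iK ih x.
have ipsi : mu.-integrable setT (EFin \o psi) by exact: integrableB i1' i2.
have -> : \int[mu]_(t in `[x, b]) (E1 ((t - x) / alpha) * f t) =
    \int[mu]_t (alpha * psi t).
  rewrite Rintegral_mkcond; apply: eq_Rintegral => t _.
  rewrite patchE mem_setE in_itv/= /psi; case: ifPn => [/andP[xt tb]|xtb].
    rewrite tb E1_kernel_nneg ?subr_ge0// [f b * _]mulrC -mulrBr -mulrA mulVKf//.
    by rewrite fh// in_itv/= tb (le_trans ax).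
  have [tx|xt] := ltP t x.
    by rewrite E1_kernel_neg ?subr_lt0// if_same mulr0 mul0r subrr mulr0.
  have bt : b < t by move: xtb; rewrite xt/= ltNge.
  by rewrite leNgt bt/= tail_eq0// !mulr0 subrr mulr0.
rewrite RintegralZl// mulKf// /psi RintegralB// RintegralZl//.
rewrite Rintegral_kernel_shift integral_shift_tail//.
have iKb : mu.-integrable setT (fun s => (K (b - s))%:E).
  exact: (integrable_reflection b iK).
have iC := integrable_convolution_adjoint iK ih.
rewrite /fderiv_density RintegralB//.
- rewrite RintegralZl//; exact: integrableS iKb.
- by apply: integrableS (integrableZl measurableT (f b) iKb).
- exact: integrableS iC.
Qed.

(** The vanishing of [K] on negative arguments cuts the line at [x], and that of [h] beyond [b] cuts
    it at [b]. *)
Lemma convolution_adjoint_itv x : a <= x ->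
  convolution_adjoint K h x = \int[mu]_(y in `[x, b]) (K (y - x) * h y).
Proof.
move=> ax; rewrite /convolution_adjoint [RHS]Rintegral_mkcond.
apply: eq_Rintegral => y _; rewrite patchE mem_setE in_itv/=.
have [xy|yx]/= := leP x y; last by rewrite E1_kernel_neg ?subr_lt0// mul0r.
by case: leP => // yb; rewrite h0 ?mulr0// in_itv/= negb_and -ltNge yb orbT.
Qed.

(** The interval is open because [fh] holds on [[a, b]] only, while a derivative depends on a whole
    neighbourhood. *)
Lemma ae_is_derive_tail_itv :
  {ae mu, forall x : R, x \in `]a, b[ -> is_derive x (1 : R) f (h x)}.
Proof.
have := ae_is_derive_tail ih.
apply: filterS; first exact: (ae_filter_ringOfSetsType mu).
move=> x dx /[!in_itv]/= /andP[ax xb].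
have dfx : is_derive x (1 : R)
    (fun z : R => f b - \int[mu]_(y in `[z, +oo[) h y) (h x).
  rewrite -[h x]opprK -[- - h x]add0r; exact: is_deriveB.
apply: near_eq_is_derive dfx; near=> z.
rewrite [RHS]fh// in_itv/=; apply/andP; split; apply/ltW; near: z.
  exact: lt_nbhsr.
exact: lt_nbhsl.
Unshelve. all: by end_near. Qed.

Let g0 x : R := \int[mu]_(s in `[x, +oo[) fderiv_density s.

Let AC_g0 : is_AC_representative a b (right_fint alpha b f) g0.
Proof.
split.
  exact: Rintegral_tail_absolutely_continuous integrable_fderiv_density _ _.
by apply: aeW => x /= /[!in_itv]/= /andP[ax xb]; exact: right_fintE.
Qed.

Lemma has_AC_right_fint : has_AC_representative a b (right_fint alpha b f).
Proof. by exists g0. Qed.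

(** The representative is a choice, but it agrees with [g0] on []a, b[] by uniqueness, hence has the
    same derivative there. *)
Lemma ae_is_derive_AC_representative :
  {ae mu, forall x : R, x \in `]a, b[ -> is_derive x (1 : R)
    (AC_representative a b (right_fint alpha b f)) (- fderiv_density x)}.
Proof.
have [acg gJ] : is_AC_representative a b (right_fint alpha b f)
    (AC_representative a b (right_fint alpha b f)).
  by apply: xgetPex; exact: has_AC_right_fint.
set g := AC_representative _ _ _ in acg gJ *.
have [acg0 g0J] := AC_g0.
have gg0 x : a < x -> x < b -> g0 x = g x.
  apply: ae_eq_continuous_eq acg0 acg _.
  exact: ae_eq_trans (ae_eq_sym g0J) gJ.
have := ae_is_derive_tail integrable_fderiv_density.
apply: filterS; first exact: (ae_filter_ringOfSetsType mu).
move=> x dx /[!in_itv]/= /andP[ax xb].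
apply: near_eq_is_derive dx; near=> z.
apply: gg0; near: z; [exact: lt_nbhsr|exact: lt_nbhsl].
Unshelve. all: by end_near. Qed.

End right_fractional_integral.

(** * The formula at almost every point *)

Lemma ae_neq (R : realType) (c : R) : {ae @lebesgue_measure R, forall x, x != c}.
Proof.
exists [set c]; split => //; first exact: lebesgue_measure_set1.
by move=> x /= /negP; rewrite negbK => /eqP.
Qed.

Unset Implicit Arguments.

Theorem theorem4p10 (R : realType) (alpha a b : R) (f : R -> R)
    (alpha_gt0 : 0 < alpha) (ltab : a < b)
    (acf : absolutely_continuous_on a b f) :
  right_fderiv_exists_ae alpha a b f /\
  {ae lebesgue_measure, forall x : R, x \in `[a, b] ->
     right_fderiv alpha a b f x =
       - f b * (alpha^-1 * E1 ((b - x) / alpha)) +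
       \int[lebesgue_measure]_(y in `[x, b])
         (alpha^-1 * E1 ((y - x) / alpha) * f^`()%classic y)}.
Proof.
have [h [ih h0 fh]] := absolutely_continuous_on_tail ltab acf.
have der := ae_is_derive_AC_representative alpha_gt0 ih h0 fh.
have fder := ae_is_derive_tail_itv ih fh.
have FF := ae_filter_ringOfSetsType (@lebesgue_measure R).
(* At the endpoints a two-sided derivative would depend on values outside [[a, b]]; they form a null
   set. *)
have nab : {ae @lebesgue_measure R, forall x, x \in `[a, b] -> x \in `]a, b[}.
  apply: (@filterS2 _ _ FF _ _ _ _ (ae_neq a) (ae_neq b)) => x xa xb.
  rewrite !in_itv/= !lt_neqAle eq_sym xa xb.
  by move=> /andP[-> ->].
split.
  split; first exact: has_AC_right_fint alpha_gt0 ih h0 fh.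
  by apply: (@filterS2 _ _ FF _ _ _ _ der nab) => x dx nx /nx /dx [].
apply: (@filterS2 _ _ FF _ _ _ _ der nab) => x dx nx xab.
have xoo := nx xab; have := dx xoo => -[dgx gx].
rewrite /right_fderiv derive1E gx /fderiv_density.
move: xab; rewrite in_itv/= => /andP[ax xb].
rewrite opprB addrC mulNr E1_kernel_nneg ?subr_ge0//; congr (_ + _).
rewrite (convolution_adjoint_itv _ h0 ax).
(* The derivative of [f] is known to be [h] only almost everywhere on [[x, b]], which the integral
   does not see. *)
apply: ae_eq_Rintegral.
apply: (@filterS2 _ _ FF _ _ _ _ fder nab) => y dy ny /= /[dup] yxb.
rewrite in_itv/= => /andP[xy yb].
have /ny/dy[_ hy] : y \in `[a, b] by rewrite in_itv/= yb (le_trans ax).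
by rewrite E1_kernel_nneg ?subr_ge0// derive1E hy.
Qed.
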